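(* Let $q$ be a prime power and let $1\le k,l\le n-1$ be integers with $kl<n$. If $g_{q-1}$ on $\mathbb F_{q^n}$ is neither $k$th order sum-free nor $l$th order sum-free, then $g_{q-1}$ is not $(k+l)$th order sum-free.
   Context: $g_{q-1}:\mathbb F_{q^n}\to\mathbb F_{q^n}$ is defined by $g_{q-1}(x)=1/x^{q-1}$ for $x\ne 0$ and $g_{q-1}(0)=0$. A function $f:\mathbb F_{q^n}\to\mathbb F_{q^n}$ is $k$th order sum-free if $\sum_{x\in A}f(x)\ne0$ for every $k$-dimensional $\mathbb F_q$-affine subspace $A$ of $\mathbb F_{q^n}$. *)

(* Defs.v *)
From HB Require Import structures.
From mathcomp Require Import all_boot all_order all_algebra all_field.

Set Implicit Arguments.
Unset Strict Implicit.
Unset Printing Implicit Defensive.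

Import GRing.Theory.
Local Open Scope ring_scope.

(* F plays the role of F_q and the extension L that of F_{q^n}, where
   q = #|F| and n = \dim {:L}. The alias [finvect_type L] is L together with
   its finType structure, which sums over subsets of L require. *)

Definition g (F : finFieldType) (L : fieldExtType F) (d : nat) (x : L) : L :=
  if x == 0 then 0 else 1 / x ^+ d.

Definition affine_subspace (F : finFieldType) (L : fieldExtType F) (k : nat)
    (A : {set finvect_type L}) : Prop :=
  exists (a : finvect_type L) (V : {vspace finvect_type L}),
    \dim V = k /\ A = [set a + v | v in V].

Definition sum_free (F : finFieldType) (L : fieldExtType F) (k : nat)
    (f : L -> L) : Prop :=
  forall A : {set finvect_type L},
    affine_subspace k A -> \sum_(x in A) f x <> 0.

(* Main.v *)
From HB Require Import structures.
Require Import Defs.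
From mathcomp Require Import all_boot all_order all_algebra all_field.
From mathcomp Require Import all_fingroup all_solvable zify.

(** For a subspace V with subspace polynomial f (F_q-linear, with kernel V), the
    sum of 1/u^(q-1) over a coset x + V, x outside V, is c / f(x)^(q-1) with
    c <> 0. Hence a vanishing affine sum comes from a linear subspace. Given
    linear V and W of dimensions k and l with vanishing sums, f(L) has
    codimension k, so kl < n yields d <> 0 with dW inside f(L). Summing over
    U = f^-1(dW) along the fibres of f, the fibre of 0 contributes the sum over V
    and the others contribute c times the sum over dW, so the sum over U
    vanishes, and U has dimension k + l. *)

Set Implicit Arguments.
Unset Strict Implicit.
Unset Printing Implicit Defensive.

Import GRing.Theory FinRing.Theory.
Local Open Scope ring_scope.

(** Logarithmic derivative of a split polynomial. *)
Lemma sum_inv_subr (K : fieldType) (s : seq K) (y : K) :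
  y \notin s ->
  let p := \prod_(a <- s) ('X - a%:P) in
  \sum_(a <- s) (y - a)^-1 = p^`().[y] / p.[y].
Proof.
elim: s => [|a s IHs] /=; first by rewrite !big_nil derivC horner0 mul0r.
rewrite inE negb_or => /andP[neq_ya y_s]; move/(_ y_s): IHs => /= IHs.
have y_a : y - a != 0 by rewrite subr_eq0.
have py : (\prod_(b <- s) ('X - b%:P)).[y] != 0.
  by rewrite -[_ == 0]/(root _ _) root_prod_XsubC.
rewrite !big_cons IHs derivM derivXsubC mul1r !hornerE.
by rewrite mulrDl invfM mulrCA mulfV // mulr1 mulrACA divff ?mul1r.
Qed.

(** * The map x^q and sums over an affine line *)

Section Frobenius.
Variables (F : finFieldType) (E : fieldExtType F).

Lemma pnat_card_ext : [pchar E].-nat #|F|.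
Proof.
have [p pr_p charFp] := finPcharP F.
have /abelem_pgroup := fin_ring_pchar_abelem charFp.
rewrite /pgroup cardsT; apply: sub_in_pnat => r _ /eqnP ->.
by rewrite pchar_lalg.
Qed.

Lemma natr_card_ext : #|F|%:R = 0 :> E.
Proof.
have -> : #|F|%:R = (#|F|%:R : F)%:A :> E by rewrite scaler_nat.
by rewrite -zmodXgE -cardsT expg_cardG ?inE ?scale0r.
Qed.

Lemma expr_cardD (x y : E) : (x + y) ^+ #|F| = x ^+ #|F| + y ^+ #|F|.
Proof. exact: exprDn_pchar pnat_card_ext. Qed.

Lemma expr_cardZ (a : F) (x : E) : (a *: x) ^+ #|F| = a *: x ^+ #|F|.
Proof. by rewrite exprZn expf_card. Qed.

Lemma expr_card_scalar (a : F) : a%:A ^+ #|F| = a%:A :> E.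
Proof. by rewrite expr_cardZ expr1n. Qed.

Lemma prod_XsubC_scalar :
  \prod_(a : F) ('X - a%:A%:P) = 'X^#|F| - 'X :> {poly E}.
Proof.
have := congr1 (map_poly (in_alg E)) (finField_genPoly F).
rewrite rmorphB /= map_polyXn map_polyX rmorph_prod => ->.
by apply: eq_bigr => a _ /=; rewrite map_polyXsubC.
Qed.

Lemma addr_scalar_neq0 (y : E) (a : F) :
  y ^+ #|F| - y != 0 -> y + a%:A != 0.
Proof.
apply: contraNneq => /eqP; rewrite addr_eq0 => /eqP ->.
by rewrite -scaleNr expr_card_scalar subrr.
Qed.

(** Logarithmic derivative of X^q - X, whose derivative is -1. The hypothesis says that [y] lies
    outside the scalars. *)
Lemma sum_inv_addr_scalar (y : E) : y ^+ #|F| - y != 0 ->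
  \sum_(a : F) (y + a%:A)^-1 = - (y ^+ #|F| - y)^-1.
Proof.
move=> y_neq0; rewrite (reindex_inj oppr_inj) /=.
under eq_bigr do rewrite scaleNr.
have /sum_inv_subr/= : y \notin [seq a%:A | a : F].
  apply/mapP => -[a _ y_a]; move/negP: y_neq0; apply.
  by rewrite y_a expr_card_scalar subrr.
rewrite !big_image /= prod_XsubC_scalar => ->.
rewrite derivB derivXn derivX !hornerE hornerMn hornerXn -mulr_natr natr_card_ext.
by rewrite mulr0 sub0r mulN1r.
Qed.

(* Since (y + a)^q = y^q + a, each summand equals
   (y + a) / (y^q + a) = 1 - (y^q - y) / (y^q + a), and the sum of the
   1 / (y^q + a) is the q-th power of the sum of the 1 / (y + a). *)
Lemma sum_inv_expr_addr_scalar (y : E) : y ^+ #|F| - y != 0 ->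
  \sum_(a : F) ((y + a%:A) ^+ #|F|.-1)^-1 = ((y ^+ #|F| - y) ^+ #|F|.-1)^-1.
Proof.
move=> y_neq0; set P := y ^+ #|F| - y.
have q_gt0 : (0 < #|F|)%N := ltnW (finNzRing_gt1 F).
have sum_expr : \sum_(a : F) (y + a%:A)^-1 ^+ #|F| = - P^-1 ^+ #|F|.
  have expr0q : 0 ^+ #|F| = 0 :> E by rewrite expr0n gtn_eqF.
  have exprD : {morph (fun x : E => x ^+ #|F|) : u v / u + v}.
    by move=> u v; exact: expr_cardD.
  rewrite -(big_morph _ exprD expr0q) sum_inv_addr_scalar //.
  by rewrite exprNn_pchar ?pnat_card_ext.
have summand a : ((y + a%:A) ^+ #|F|.-1)^-1 = 1 - P * (y + a%:A)^-1 ^+ #|F|.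
  have ya_neq0 := addr_scalar_neq0 a y_neq0.
  apply: (mulfI (expf_neq0 #|F| ya_neq0)).
  rewrite -[in LHS](prednK q_gt0) exprSr mulrAC divff ?expf_neq0 // mul1r.
  rewrite mulrBr mulr1 mulrCA exprVn divff ?expf_neq0 // mulr1.
  by rewrite expr_cardD expr_card_scalar /P opprB [RHS]addrC addrA subrK.
under eq_bigr do rewrite summand.
rewrite big_split /= sumr_const natr_card_ext add0r sumrN -mulr_sumr sum_expr.
by rewrite mulrN opprK -[in LHS](prednK q_gt0) exprS mulVKf ?exprVn.
Qed.

(** By homogeneity, division by [z] reduces this to the line of scalars. *)
Lemma sum_inv_expr_line (y z : E) :
  z != 0 -> y ^+ #|F| - z ^+ #|F|.-1 * y != 0 ->
  \sum_(a : F) ((y + a *: z) ^+ #|F|.-1)^-1 =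
    (z ^+ #|F|.-1) ^+ #|F|.-1
      * ((y ^+ #|F| - z ^+ #|F|.-1 * y) ^+ #|F|.-1)^-1.
Proof.
move=> z_neq0; have q_gt0 : (0 < #|F|)%N := ltnW (finNzRing_gt1 F).
have -> : y ^+ #|F| - z ^+ #|F|.-1 * y
        = z ^+ #|F|.-1 * (z * ((y / z) ^+ #|F| - y / z)).
  rewrite mulrA -exprSr prednK // mulrBr expr_div_n [z ^+ _ * (_ / _)]mulrC.
  rewrite divfK ?expf_neq0 //.
  by rewrite -[in z ^+ #|F|](prednK q_gt0) exprSr -mulrA [z * _]mulrC divfK.
rewrite !mulf_eq0 !negb_or => /and3P[_ _ neq0].
under eq_bigr => a _.
  have -> : y + a *: z = z * (y / z + a%:A).
    by rewrite mulrDr [z * (_ / _)]mulrC divfK // -scalerAr mulr1.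
  rewrite exprMn invfM; over.
rewrite -mulr_sumr sum_inv_expr_addr_scalar // !exprMn !invfM.
by rewrite mulVKf ?expf_neq0.
Qed.

(** For [b] = z^(q-1), this is the subspace polynomial of the line spanned by [z]. *)
Definition frob_sub (b x : E) : E := x ^+ #|F| - b * x.

Fact frob_sub_linear (b : E) : linear (frob_sub b).
Proof.
move=> a x y; rewrite /frob_sub expr_cardD expr_cardZ mulrDr -scalerAr.
by rewrite scalerBr opprD addrACA.
Qed.

HB.instance Definition _ (b : E) :=
  GRing.isLinear.Build F E E *:%R (frob_sub b) (frob_sub_linear b).

(** If [y] is a zero, then [y / z] is a root of X^q - X, hence a scalar. *)
Lemma frob_sub_eq0 (z y : E) :
  z != 0 -> (frob_sub (z ^+ #|F|.-1) y == 0) = (y \in <[z]>%VS).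
Proof.
move=> z_neq0; have q_gt0 : (0 < #|F|)%N := ltnW (finNzRing_gt1 F).
apply/eqP/vlineP => [|[a ->]]; last first.
  by rewrite linearZ /= /frob_sub -exprSr prednK // subrr scaler0.
rewrite /frob_sub -{1}[y](divfK z_neq0) exprMn -[in z ^+ #|F|](prednK q_gt0) exprSr.
rewrite [z ^+ _ * z]mulrC mulrA [_ ^+ _ * y]mulrC -mulrBl => /eqP.
rewrite mulf_eq0 (negPf (expf_neq0 _ z_neq0)) orbF.
rewrite -[X in _ - X](divfK z_neq0) -mulrBl mulf_eq0 (negPf z_neq0) orbF => yz.
have : root ('X^#|F| - 'X) (y / z) by rewrite rootE !hornerE.
rewrite -prod_XsubC_scalar rootE horner_prod => /prodf_eq0[a _].
rewrite !hornerE subr_eq0 => /eqP yza; exists a.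
by rewrite -[y](divfK z_neq0) yza -scalerAl mul1r.
Qed.

End Frobenius.

(** * Sums over subspaces and their cosets *)

Section SubspaceSums.
Variables (F : finFieldType) (L : fieldExtType F).
Let E := finvect_type L.

(** [f^-1] picks one point of each fibre over the image; the fibres over [f @: U] lie inside [U]
    because [U] contains the kernel. *)
Lemma sum_fibers (M : nmodType) (f : 'End(E)) (U : {vspace E}) (h : E -> M) :
  (lker f <= U)%VS ->
  \sum_(u in U) h u =
    \sum_(w in (f @: U)%VS) \sum_(v in lker f) h ((f^-1)%VF w + v).
Proof.
move=> kerU.
rewrite (partition_big f (mem (f @: U)%VS)) /=; last by move=> u; apply: memv_img.
apply: eq_bigr => w wU.
have [u uU w_fu] := memv_imgP wU.
have fw : f ((f^-1)%VF w) = w by rewrite limg_lfunVK // w_fu memv_img ?memvf.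
rewrite (reindex_inj (addrI ((f^-1)%VF w))) /=.
apply: eq_bigl => v; rewrite memv_ker linearD /= fw -subr_eq0 addrAC subrr add0r.
apply: andb_idl => /eqP fv.
have : (f^-1)%VF w + v - u \in lker f.
  by rewrite memv_ker linearB linearD /= fw fv addr0 w_fu subrr.
by move=> /(subvP kerU) /(rpredD uU); rewrite addrC subrK.
Qed.

(* f is, up to a nonzero factor, the subspace polynomial of V. For q = 2 the
   formula is its logarithmic derivative; for larger q one would need a Hasse
   derivative of order q - 2, so V is built by adding one line at a time. *)
Lemma subspace_sum (V : {vspace E}) :
  exists (f : 'End(E)) (c : E),
    [/\ lker f = V, c != 0 &
      forall x, x \notin V ->
        \sum_(v in V) ((x + v) ^+ #|F|.-1)^-1 = c * (f x ^+ #|F|.-1)^-1].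
Proof.
rewrite -(span_basis (vbasisP V)); elim: (tval (vbasis V)) => [|e s].
  exists \1%VF, 1; split; rewrite ?oner_neq0 ?span_nil //.
    by apply/vspaceP => v; rewrite memv_ker id_lfunE memv0.
  move=> x _; rewrite (big_pred1 0) => [|v]; last by rewrite memv0.
  by rewrite addr0 mul1r id_lfunE.
case=> f [c [kerf c_neq0 sumf]].
have [fe0|z_neq0] := eqVneq (f e) 0.
  exists f, c; rewrite span_cons (addv_idPr _) //.
  by rewrite -memvE -kerf memv_ker fe0.
set z := f e in z_neq0; pose b := z ^+ #|F|.-1.
(* [phi] kills exactly the line through [f e], so [phi \o f] has kernel [<<e :: s>>]; the line
   formula contributes the factor [b ^+ #|F|.-1]. *)
pose phi : 'End(E) := linfun (frob_sub b).
have kerphi y : (phi y == 0) = (y \in <[z]>%VS) by rewrite lfunE frob_sub_eq0.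
have imgU : (f @: <<e :: s>>)%VS = <[z]>%VS.
  rewrite span_cons limgD limg_line -kerf.
  by rewrite (_ : f @: lker f = 0)%VS ?addv0 //; apply/eqP; rewrite -lkerE.
have kerU : (lker f <= <<e :: s>>)%VS by rewrite kerf span_cons addvSr.
have ker_comp : lker (phi \o f) = <<e :: s>>%VS.
  apply/vspaceP => v; rewrite memv_ker comp_lfunE kerphi.
  apply/idP/idP => [|vU]; last by rewrite -imgU memv_img.
  rewrite -imgU => /memv_imgP[u uU fvu].
  rewrite -[v](subrK u) rpredD // (subvP kerU) // memv_ker.
  by rewrite linearB /= fvu subrr.
exists (phi \o f)%VF, (c * b ^+ #|F|.-1); split => //.
  by rewrite mulf_neq0 ?expf_neq0.
move=> x; rewrite -ker_comp memv_ker comp_lfunE => phi_neq0.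
rewrite ker_comp (sum_fibers _ kerU) imgU.
(* Since [f x] is off the line, adding a preimage of [w] to [x] stays outside the old kernel, where
   the induction hypothesis applies. *)
have fx_w w : w \in <[z]>%VS -> f x + w != 0.
  apply: contraTneq => /eqP; rewrite addrC addr_eq0 => /eqP ->.
  by rewrite rpredN -kerphi.
under eq_bigr => w wz.
  under eq_bigr do rewrite addrA.
  have fw : f ((f^-1)%VF w) = w.
    by rewrite limg_lfunVK //; apply: subvP wz; rewrite -imgU limgS ?subvf.
  rewrite kerf sumf; last by rewrite -kerf memv_ker linearD /= fw fx_w.
  rewrite linearD /= fw; over.
rewrite -mulr_sumr -mulrA; congr (_ * _).
have -> : \sum_(w in <[z]>%VS) ((f x + w) ^+ #|F|.-1)^-1
        = \sum_(a : F) ((f x + a *: z) ^+ #|F|.-1)^-1.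
  transitivity (\sum_(w in [set a *: z | a : F]) ((f x + w) ^+ #|F|.-1)^-1).
    apply: eq_bigl => w; apply/vlineP/imsetP => [[a ->]|[a _ ->]]; by exists a.
  rewrite big_imset //= => a a' _ _ /eqP.
  by rewrite -subr_eq0 -scalerBl scaler_eq0 (negPf z_neq0) orbF subr_eq0 => /eqP.
by rewrite lfunE /= in phi_neq0 *; rewrite sum_inv_expr_line.
Qed.

Lemma g_pred_card (x : L) : g (#|F| - 1) x = (x ^+ #|F|.-1)^-1.
Proof.
rewrite /g subn1 div1r; case: eqVneq => // ->.
by rewrite expr0n -subn1 subn_eq0 leqNgt finNzRing_gt1 invr0.
Qed.

Lemma sum_affine (a : E) (V : {vspace E}) :
  \sum_(x in [set a + v | v in V]) (g (#|F| - 1) x : E) =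
    \sum_(v in V) ((a + v) ^+ #|F|.-1)^-1.
Proof.
rewrite big_imset /=; last by move=> u v _ _; apply: addrI.
by apply: eq_bigr => v _; apply: g_pred_card.
Qed.

(** If [a] lies in [V], translation by [a] permutes [V]. Otherwise the affine sum is c / f(a)^(q-1),
    which is nonzero, against the hypothesis. *)
Lemma affine_sum_eq0 (a : E) (V : {vspace E}) :
  \sum_(x in [set a + v | v in V]) (g (#|F| - 1) x : E) = 0 ->
  \sum_(v in V) (v ^+ #|F|.-1)^-1 = 0.
Proof.
rewrite sum_affine; have [aV|aV] := boolP (a \in V).
  rewrite [in X in _ -> X](reindex_inj (addrI a)) /= => a0; rewrite -[RHS]a0.
  by apply: eq_bigl => v; rewrite rpredDl.
have [f [c [kerf c_neq0 sumf]]] := subspace_sum V.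
rewrite sumf // => /eqP.
by rewrite mulf_eq0 (negPf c_neq0) invr_eq0 expf_eq0 -memv_ker kerf (negPf aV) andbF.
Qed.

Lemma sum_preim_eq0 (V W : {vspace E}) (f : 'End(E)) (c : E) :
  lker f = V -> (W <= limg f)%VS ->
  (forall x, x \notin V ->
     \sum_(v in V) ((x + v) ^+ #|F|.-1)^-1 = c * (f x ^+ #|F|.-1)^-1) ->
  \sum_(v in V) (v ^+ #|F|.-1)^-1 = 0 ->
  \sum_(w in W) (w ^+ #|F|.-1)^-1 = 0 ->
  \sum_(u in (f @^-1: W)%VS) (u ^+ #|F|.-1)^-1 = 0.
Proof.
move=> kerf Wf sumf V0 W0.
have kerU : (lker f <= f @^-1: W)%VS by rewrite -lpreim0 lpreimS ?sub0v.
rewrite (sum_fibers _ kerU) lpreimK //.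
transitivity (\sum_(w in W) c * (w ^+ #|F|.-1)^-1); last first.
  by rewrite -mulr_sumr W0 mulr0.
apply: eq_bigr => w wW.
have fw : f ((f^-1)%VF w) = w by rewrite limg_lfunVK // (subvP Wf).
rewrite kerf; have [w0|w_neq0] := eqVneq w 0.
  (* The fibre over 0 is [V] itself, with sum 0; the right side is also 0, since 0 inverts to 0. *)
  have q1_gt0 : (0 < #|F|.-1)%N by rewrite -subn1 subn_gt0 finNzRing_gt1.
  rewrite w0 linear0 expr0n gtn_eqF // invr0 mulr0 -[RHS]V0.
  by apply: eq_bigr => v _; rewrite add0r.
by rewrite sumf ?fw // -kerf memv_ker fw.
Qed.

(** Scaling by [d] multiplies every summand by d^-(q-1). *)
Lemma sum_scaled_eq0 (W : {vspace E}) (d : E) : d != 0 ->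
  \sum_(w in W) (w ^+ #|F|.-1)^-1 = 0 ->
  \sum_(w in (W * <[d]>)%VS) (w ^+ #|F|.-1)^-1 = 0.
Proof.
move=> d_neq0 W0; rewrite (reindex_inj (mulIf d_neq0)) /=.
under eq_bigr do rewrite exprMn invfM.
rewrite -mulr_suml (eq_bigl (mem W)) ?W0 ?mul0r // => w.
apply/memv_cosetP/idP => [[u uW /(mulIf d_neq0) ->] //|wW].
by exists w.
Qed.

End SubspaceSums.

(** * Scaling one subspace into another *)

Section Scaling.
Variables (K : fieldType) (E : fieldExtType K).

(** Each [U * <[w^-1]>] has the dimension of [U], so intersecting with it costs at most the
    codimension of [U]. *)
Lemma dim_bigcap_scaled (U : {vspace E}) (s : seq E) : 0 \notin s ->
  (\dim {:E} <= \dim (\bigcap_(w <- s) (U * <[w^-1]>))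
                 + size s * (\dim {:E} - \dim U))%N.
Proof.
elim: s => [|w s IHs]; first by rewrite big_nil mul0n addn0.
rewrite inE negb_or eq_sym => /andP[w_neq0 /IHs {}IHs].
rewrite big_cons /= mulSn; set I := (\bigcap_(_ <- _) _)%VS in IHs *.
have := dimv_sum_cap (U * <[w^-1]>) I.
rewrite dim_cosetv ?invr_eq0 // => dimI.
have arith (n u i j p m : nat) : (n <= i + m -> p + j = u + i ->
  u <= n -> p <= n -> n <= j + (n - u + m))%N by lia.
exact: arith IHs dimI (dimvS (subvf U)) (dimvS (subvf _)).
Qed.

(* c W lies in U iff c lies in every w^-1 U, w ranging over a basis of W:
   each of these conditions has the codimension of U. *)
Lemma exists_scaling (U W : {vspace E}) :
  (\dim W * (\dim {:E} - \dim U) < \dim {:E})%N ->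
  exists2 c : E, c != 0 & (W * <[c]> <= U)%VS.
Proof.
move=> small; have freeW := basis_free (vbasisP W).
have W0 : 0 \notin (vbasis W : seq E).
  by apply/negP => /(free_not0 freeW); rewrite eqxx.
have := dim_bigcap_scaled U W0.
rewrite size_tuple; set I := (\bigcap_(_ <- _) _)%VS => dimI.
have I_neq0 : I != 0%VS by rewrite -dimv_eq0; lia.
exists (vpick I); first by rewrite vpick0.
apply/subvP => _ /memv_cosetP[w wW ->]; move: w wW.
(* In the form W inside c^-1 U, the inclusion can be tested on a basis of [W]. *)
suff WU : (W <= U * <[(vpick I)^-1]>)%VS.
  move=> w /(subvP WU)/memv_cosetP[u uU ->].
  by rewrite divfK // vpick0.
rewrite -(span_basis (vbasisP W)); apply/span_subvP => w wW.
have /memv_cosetP[u uU cE] : vpick I \in (U * <[w^-1]>)%VS.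
  by apply: subvP (memv_pick I); rewrite /I (big_rem _ wW) capvSl.
have w_neq0 : w != 0 by apply: contraNneq W0 => <-.
have u_neq0 : u != 0.
  by apply: contraNneq I_neq0 => u0; rewrite -vpick0 cE u0 mul0r.
apply/memv_cosetP; exists u => //.
by rewrite cE invfM invrK mulVKf.
Qed.

End Scaling.

Theorem theorem4p11 (q n k l : nat) (F : finFieldType) (L : fieldExtType F)
    (hq : #|F| = q) (hn : \dim {:L} = n)
    (hk : (1 <= k <= n - 1)%N) (hl : (1 <= l <= n - 1)%N)
    (hkl : (k * l < n)%N)
    (hgk : ~ sum_free k (@g F L (q - 1)))
    (hgl : ~ sum_free l (@g F L (q - 1))) :
  ~ sum_free (k + l) (@g F L (q - 1)).
Proof.
subst q n => hgkl.
(* The goal being [False], each failure of sum-freeness yields an actual subspace with vanishing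
   sum, made linear by [affine_sum_eq0]. *)
apply: hgk => _ [a [V [dimV ->]]] /affine_sum_eq0 V0.
apply: hgl => _ [b [W [dimW ->]]] /affine_sum_eq0 W0.
have [f [c [kerf c_neq0 sumf]]] := subspace_sum V.
have dimf : (k + \dim (limg f) = \dim {:L})%N.
  by have := limg_ker_dim f fullv; rewrite capfv kerf dimV.
have [|d d_neq0 Wd] := @exists_scaling F (finvect_type L) (limg f) W.
  rewrite dimW -[X in (_ * (X - _) < _)%N]dimf addnK mulnC.
  exact: hkl.
apply: (hgkl [set 0 + u | u in (f @^-1: (W * <[d]>))%VS]).
  exists 0, (f @^-1: (W * <[d]>))%VS; split=> //.
  (* The kernel contributes [k] to the dimension and the image contributes [l]. *)
  rewrite -(limg_ker_dim f) lpreimK // dim_cosetv // dimW.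
  by rewrite (capv_idPr _) ?kerf ?dimV // -kerf -lpreim0 lpreimS ?sub0v.
rewrite sum_affine; under eq_bigr do rewrite add0r.
apply: (sum_preim_eq0 kerf Wd sumf V0).
exact: sum_scaled_eq0.
Qed.
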